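(* Let $G=(V,E)$ be a loop-free multigraph. Every vertex order $\sigma$ produced by the greedy algorithm (with any tie-breaking) satisfies $\sum_{v\in V}\overleftarrow{d}_\sigma(v)^2\le \overleftarrow{d}_{\min}(G)\cdot \min_{\tau}\sum_{v\in V}\overleftarrow{d}_\tau(v)^2$, where the minimum is over all vertex orders $\tau$ of $G$; i.e., the greedy algorithm is a $\overleftarrow{d}_{\min}(G)$-approximation for minimizing $\sum_{v\in V}\overleftarrow{d}(v)^2$.
   Context: A vertex order is a linear ordering $\sigma=(\sigma_1,\dots,\sigma_n)$ of $V$; the left-degree $\overleftarrow{d}_\sigma(v)$ of $v=\sigma_i$ is the number of edges (with multiplicity) joining $v$ to $\{\sigma_1,\dots,\sigma_{i-1}\}$. A vertex order is $k$-bounded if every left-degree is at most $k$; the degeneracy $\overleftarrow{d}_{\min}(G)$ is the smallest $k$ for which a $k$-bounded order exists. The greedy algorithm builds the order from right to left: repeatedly, it picks a vertex of minimum degree in the current (remaining) graph, places it at the last still-free position, and deletes it from the graph. *)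

(* Defs.v *)
From HB Require Import structures.
From mathcomp Require Import all_boot.

Set Implicit Arguments.
Unset Strict Implicit.
Unset Printing Implicit Defensive.

(* Parallel edges are distinct elements of [edge] with the same [ends];
   loop-freeness is the requirement that every edge has two distinct ends. *)
Record multigraph (V : finType) := Multigraph {
  edge : finType;
  ends : edge -> {set V};
  card_ends : forall e, #|ends e| = 2
}.

Record vertex_order (V : finType) := VertexOrder {
  order_tuple :> #|V|.-tuple V;
  order_uniq : uniq order_tuple
}.

HB.instance Definition _ (V : finType) :=
  [isSub of vertex_order V for @order_tuple V].
HB.instance Definition _ (V : finType) := [Finite of vertex_order V by <:].

Definition enum_order (V : finType) : vertex_order V :=
  VertexOrder (enum_uniq V : uniq (enum_tuple V)).

Section Multigraph.
Variables (V : finType) (G : multigraph V).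
Implicit Types (v u : V) (s : vertex_order V) (R : {set V}).

Definition left_degree s v : nat :=
  #|[set e : edge G | [exists u in take (index v s) s, ends e == [set v; u]]]|.

Definition k_bounded (k : nat) s : bool := [forall v, left_degree s v <= k].

Lemma exists_bounded : exists k, [exists s, k_bounded k s].
Proof.
exists #|edge G|; apply/existsP; exists (enum_order V).
by apply/forallP => v; apply: max_card.
Qed.

Definition degeneracy : nat := ex_minn exists_bounded.

Definition sum_sq_left_degree s : nat := \sum_(v : V) left_degree s v ^ 2.

(* [enum_order V] only witnesses that there is some vertex order. *)
Definition min_sum_sq_left_degree : nat :=
  sum_sq_left_degree [arg min_(t < enum_order V) sum_sq_left_degree t].

(* For v in R, the degree of v in the subgraph induced by R. *)
Definition degree_in R v : nat :=
  #|[set e : edge G | (v \in ends e) && (ends e \subset R)]|.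

(* [greedy_run R w]: the algorithm can reach the state in which R is the set of
   remaining vertices and w is the list of vertices occupying, from left to
   right, the last size w positions. *)
Inductive greedy_run : {set V} -> seq V -> Prop :=
| greedy_start : greedy_run [set: V] [::]
| greedy_step R w v :
    greedy_run R w -> v \in R ->
    (forall u, u \in R -> degree_in R v <= degree_in R u) ->
    greedy_run (R :\ v) (v :: w).

Definition greedy_order s : Prop := greedy_run set0 s.

Lemma greedy_run_uniq R w :
  greedy_run R w -> uniq w /\ (forall v, (v \in w) = (v \notin R)).
Proof.
elim=> [|{}R {}w v _ [Uw mem_w] vR _]; first by split=> // v; rewrite !inE.
split=> [|u]; first by rewrite /= mem_w vR.
by rewrite !inE mem_w negb_and negbK.
Qed.

(* Hence no output is lost by typing [greedy_order] on vertex orders. *)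
Lemma greedy_run_order w :
  greedy_run set0 w -> exists2 s : vertex_order V, greedy_order s & w = s.
Proof.
move=> run_w; have [Uw mem_w] := greedy_run_uniq run_w.
have sz_w : size w == #|V|.
  by rewrite -(card_uniqP Uw); apply/eqP/eq_card => v; rewrite mem_w !inE.
by exists (@VertexOrder V (Tuple sz_w) Uw).
Qed.

Lemma greedy_order_exists : exists s, greedy_order s.
Proof.
suff run n : n <= #|V| -> exists R w, greedy_run R w /\ #|R| = #|V| - n.
  have [R [w [run_w]]] := run _ (leqnn _).
  rewrite subnn => /eqP; rewrite cards_eq0 => /eqP R0.
  by rewrite R0 in run_w; have [s] := greedy_run_order run_w; exists s.
elim: n => [_|n IHn lt_nV].
  by exists setT, [::]; rewrite cardsT subn0; split=> //; apply: greedy_start.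
have [R [w [run_w cardR]]] := IHn (ltnW lt_nV).
have /card_gt0P[v0 v0R] : 0 < #|R| by rewrite cardR subn_gt0.
have [v vR min_v] :
    exists2 v, v \in R & forall u, u \in R -> degree_in R v <= degree_in R u.
  by case: (@arg_minnP _ v0 (mem R) (degree_in R) v0R) => v; exists v.
exists (R :\ v), (v :: w); split; first exact: greedy_step.
by have := cardsD1 v R; rewrite vR cardR subnS => ->.
Qed.

End Multigraph.

(* Main.v *)
(* The left-degrees of any order sum to the number m of edges, and x <= x^2 on
   the naturals, so every order has cost at least m.  A greedy order is d-bounded
   for d the degeneracy: the vertex it removes from the current set R has at most
   the degree in G[R] of the last vertex of R in a d-bounded order, which is at
   most d.  Hence its cost is at most d * m. *)
Require Import Defs.
From mathcomp Require Import all_boot.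

Section LeftDegree.

Set Implicit Arguments.
Unset Strict Implicit.

Variable V : finType.

Lemma mem_vertex_order (s : vertex_order V) v :
  v \in (s : seq V).
Proof.
have /card_uniqP card_s := order_uniq s.
have /subset_cardP/(_ (subset_predT _))-> // : #|(s : seq V)| = #|V|.
by rewrite card_s size_tuple.
Qed.

Lemma eq_index_vertex_order (s : vertex_order V) u v :
  (index u s == index v s) = (u == v).
Proof.
apply/eqP/eqP => [/(congr1 (nth u s))|->//].
by rewrite !nth_index ?mem_vertex_order.
Qed.

Variable G : multigraph V.
Implicit Types (s t : vertex_order V) (R : {set V}).

(** Turns left-degree into degree in an induced subgraph. The non-strict bound keeps [v] itself in
    the prefix; it costs nothing because the other end of [e] differs from [v], hence has another
    index. *)
Lemma mem_left_edges s v (e : edge G) :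
  [exists u in take (index v s) s, ends e == [set v; u]] =
  (v \in ends e) && (ends e \subset [set u | index u s <= index v s]).
Proof.
apply/exists_inP/andP => [[u u_lt_v /eqP ->]|[v_e le_v]].
  rewrite in_take ?mem_vertex_order // in u_lt_v.
  by rewrite set21 subUset !sub1set !inE leqnn ltnW.
have /eqP/cards2P[a [b [neq_ab e_ab]]] := card_ends e.
wlog v_a : a b neq_ab e_ab / v = a => [wlog_a|].
  have /set2P[] : v \in [set a; b] by rewrite -e_ab.
    exact: (wlog_a a b).
  by apply: (wlog_a b a); rewrite 1?eq_sym // setUC.
exists b; last by rewrite e_ab v_a.
rewrite in_take ?mem_vertex_order // ltn_neqAle eq_index_vertex_order v_a.
by rewrite eq_sym neq_ab -v_a; move/subsetP/(_ b): le_v; rewrite e_ab set22 inE; apply.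
Qed.

Lemma left_degreeE s v :
  left_degree G s v = degree_in G [set u | index u s <= index v s] v.
Proof. by apply: eq_card => e; rewrite !inE mem_left_edges. Qed.

Lemma degree_in_subset R R' v :
  R \subset R' -> degree_in G R v <= degree_in G R' v.
Proof.
move=> sRR'; apply/subset_leq_card/subsetP => e; rewrite !inE.
by move=> /andP[-> /subset_trans->].
Qed.

(** Double counting: each edge contributes to exactly one left-degree, that of its end of largest
    index. *)
Lemma sum_left_degree s : \sum_v left_degree G s v = #|edge G|.
Proof.
under eq_bigr => v _ do rewrite left_degreeE /degree_in -sum1dep_card big_mkcond.
rewrite exchange_big -[RHS]sum1_card; apply: eq_bigr => e _ /=.
have [a0 a0_e] : exists a, a \in ends e.
  by apply/set0Pn; rewrite -card_gt0 card_ends.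
have [a a_e max_a] := arg_maxnP (fun v => index v s) a0_e.
rewrite -big_mkcond (big_pred1 a) // => v; apply/andP/eqP => [[v_e]|->].
  move=> /subsetP/(_ a a_e); rewrite inE => le_av.
  by apply/eqP; rewrite -(eq_index_vertex_order s) eqn_leq le_av andbT; apply: max_a.
by split=> //; apply/subsetP => u /max_a; rewrite inE.
Qed.

Lemma card_edge_le_sum_sq s : #|edge G| <= sum_sq_left_degree G s.
Proof.
rewrite -(sum_left_degree s); apply: leq_sum => v _.
by case: (left_degree G s v) => // n; rewrite leq_pmull.
Qed.

Lemma sum_sq_bounded k s :
  k_bounded G k s -> sum_sq_left_degree G s <= k * #|edge G|.
Proof.
move=> /forallP bnd; rewrite -(sum_left_degree s) big_distrr.
by apply: leq_sum => v _; rewrite leq_mul2r bnd orbT.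
Qed.

Lemma exists_degree_in_le_degeneracy R v :
  v \in R -> exists2 u, u \in R & degree_in G R u <= degeneracy G.
Proof.
move=> v_R; rewrite /degeneracy; case: ex_minnP => k /existsP[t /forallP bnd] _.
have [u u_R max_u] := arg_maxnP (fun x => index x t) v_R.
(* By maximality of [u], [R] lies inside the prefix of [t] ending at [u]. *)
exists u => //; apply: leq_trans (bnd u); rewrite left_degreeE.
by apply/degree_in_subset/subsetP => x /max_u; rewrite inE.
Qed.

(** The prefix [p] varies in the induction: undoing a greedy step moves the head of the suffix to
    the end of [p], while [s] stays fixed. *)
Lemma greedy_run_left_degree R w s p :
  greedy_run G R w -> s = p ++ w :> seq V ->
  {in w, forall v, left_degree G s v <= degeneracy G}.
Proof.
move=> run_w; elim: run_w p => {R w} // R w v run_w IHw v_R min_v p s_pvw x.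
rewrite inE => /predU1P[->|]; last by apply: (IHw (rcons p v)); rewrite cat_rcons.
have [_ mem_w] := greedy_run_uniq run_w.
have := order_uniq s; rewrite s_pvw cat_uniq /= negb_or.
move=> /and3P[_ /andP[v_p /hasPn p_w] _].
(* [w] lists the complement of [R], so [R] is exactly the prefix of [s] ending at [v]. *)
have -> : left_degree G s v = degree_in G R v.
  rewrite left_degreeE; congr degree_in; apply/setP => u.
  rewrite inE s_pvw !index_cat (negbTE v_p) /= eqxx addn0 -[RHS]negbK -mem_w.
  case: ifPn => [u_p|u_p].
    by rewrite ltnW ?index_mem //; apply/esym/negP => /p_w/negP.
  have [<-|neq_vu] := eqVneq v u; first by rewrite addn0 leqnn mem_w v_R.
  (* The remaining [u] lie in [w], so their index exceeds [size p], the index of [v]. *)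
  have := mem_vertex_order s u; rewrite s_pvw mem_cat inE (negbTE u_p).
  by rewrite eq_sym (negbTE neq_vu) addnS ltnNge leq_addr => /= ->.
have [u u_R] := exists_degree_in_le_degeneracy v_R.
exact/leq_trans/min_v.
Qed.

Lemma greedy_order_bounded s :
  greedy_order G s -> k_bounded G (degeneracy G) s.
Proof.
move=> run_s; apply/forallP => v.
by apply: (@greedy_run_left_degree _ _ s [::] run_s); rewrite ?mem_vertex_order.
Qed.

End LeftDegree.

Theorem theorem7 (V : finType) (G : multigraph V) (sigma : vertex_order V)
    (greedy_sigma : greedy_order G sigma) :
  sum_sq_left_degree G sigma <= degeneracy G * min_sum_sq_left_degree G.
Proof.
apply: leq_trans (sum_sq_bounded (greedy_order_bounded greedy_sigma)) _.
by rewrite leq_mul2l card_edge_le_sum_sq orbT.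
Qed.
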